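(* In the unbounded forecasting game, Reality can strongly comply with the event \[\sum_n \frac{v_n}{n^2}<\infty\iff\lim_{n\to\infty}\frac{1}{n}\sum_{i=1}^n(x_i-m_i)=0 .\]
   Context: Unbounded forecasting game (players Forecaster, Skeptic, Reality; perfect information): $\mathcal{K}_0:=1$. For $n=1,2,\ldots$: Forecaster announces $m_n\in\mathbb{R}$ and $v_n\ge0$; then Skeptic announces $M_n\in\mathbb{R}$ and $V_n\ge0$; then Reality announces $x_n\in\mathbb{R}$; then $\mathcal{K}_n:=\mathcal{K}_{n-1}+M_n(x_n-m_n)+V_n((x_n-m_n)^2-v_n)$. Collateral duty of Skeptic: he must keep $\mathcal{K}_n$ non-negative for all $n$. A path is the infinite sequence $\xi=(m_1,v_1,x_1,m_2,v_2,x_2,\ldots)$ of moves of Forecaster and Reality; the sample space $\Omega$ is the set of all paths, and an event is any subset $E\subseteq\Omega$. A strategy of Reality is a deterministic rule giving $x_n$ as a function of all moves of all players made before it (including $m_n,v_n,M_n,V_n$). Reality strongly complies with an event $E$ by a strategy $R$ if, whenever Reality follows $R$, irrespective of the moves of Forecaster and Skeptic (with Skeptic observing his collateral duty), (i) the resulting path $\xi$ belongs to $E$, and (ii) $\mathcal{K}_n\le\mathcal{K}_0$ for all $n$. Reality can strongly comply with $E$ if such a strategy exists. *)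

(* Defs.v *)
From HB Require Import structures.
From mathcomp Require Import all_boot all_order all_algebra.
From mathcomp Require Import all_classical all_reals all_analysis.
Import Order.TTheory GRing.Theory Num.Theory.
Import numFieldNormedType.Exports.

Set Implicit Arguments.
Unset Strict Implicit.
Unset Printing Implicit Defensive.

Local Open Scope classical_set_scope.
Local Open Scope ring_scope.

(* Rounds are numbered from 0: what is written m_n, v_n, M_n, V_n, x_n with
   n >= 1 is stored at index n - 1.  The capital K_n keeps its index, K_0 = 1
   being the capital before any round is played. *)

Section UnboundedForecastingGame.
Variable R : realType.

Record forecaster_move := ForecasterMove { fmean : R ; fvar : {nonneg R} }.

Record skeptic_move := SkepticMove { slin : R ; squad : {nonneg R} }.

Record round := Round {
  forecast : forecaster_move ;
  bet : skeptic_move ;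
  outcome : R }.

Definition play := nat -> round.

(* The sample space Omega. *)
Definition game_path := nat -> forecaster_move * R.

Definition event := set game_path.

Definition path_of (p : play) : game_path :=
  fun n => (forecast (p n), outcome (p n)).

Definition gain (r : round) : R :=
  let d := outcome r - fmean (forecast r) in
  slin (bet r) * d + (squad (bet r))%:num * (d ^+ 2 - (fvar (forecast r))%:num).

Fixpoint capital (p : play) (n : nat) : R :=
  if n is k.+1 then capital p k + gain (p k) else 1.

(* The arguments are all the completed rounds, in chronological order, and then
   the moves of Forecaster and Skeptic in the current round. *)
Definition reality_strategy :=
  seq round -> forecaster_move -> skeptic_move -> R.

Definition follows (S : reality_strategy) (p : play) : Prop :=
  forall n, outcome (p n) = S (mkseq p n) (forecast (p n)) (bet (p n)).

(* The duty is imposed only on the capital process actually realized in the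
   play, not on the capital under the moves Reality could have made instead. *)
Definition collateral_duty (p : play) : Prop := forall n, 0 <= capital p n.

Definition strongly_complies (S : reality_strategy) (E : event) : Prop :=
  forall p : play, follows S p -> collateral_duty p ->
    E (path_of p) /\ (forall n, capital p n <= capital p 0).

Definition can_strongly_comply (E : event) : Prop :=
  exists S : reality_strategy, strongly_complies S E.

End UnboundedForecastingGame.

(* Main.v *)
(* Let Reality deviate from m_n only by 0 or +-a_n, a_n = max(n, sqrt v_n), as if
   at random with total probability p_n = v_n / a_n^2 of a non-zero deviation, a
   jump.  Such a deviation has mean 0 and variance v_n, so Skeptic's capital K is a
   martingale.  Since jumps have size at least n, averages tend to 0 iff there are
   finitely many jumps; and sum v_n / n^2 < oo iff sum p_n < oo.  The event thus
   becomes a Borel-Cantelli statement, which is derandomized with the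
   supermartingale L = 2^N e^(-P) + 2^(-N) e^(P/2), where N counts the jumps and P
   sums the p_n: if L is bounded, N and P are bounded together.  Reality keeps
   (1 - K) / L nondecreasing, and L nonincreasing as long as K = 1.  Once K < 1,
   the duty K >= 0 then bounds L. *)
Require Import Defs.
From HB Require Import structures.
From mathcomp Require Import all_boot all_order all_algebra.
From mathcomp Require Import all_classical all_reals all_analysis.
From mathcomp Require Import ring lra.
Import Order.TTheory GRing.Theory Num.Theory.
Import numFieldNormedType.Exports.

Local Open Scope classical_set_scope.
Local Open Scope ring_scope.

(** * Series of nonnegative terms, through bounded partial sums *)

Section BoundedSums.
Variable R : realType.
Implicit Types u w : nat -> R.

Definition bounded_sums u := exists B, forall n, \sum_(0 <= i < n) u i <= B.

Lemma ler_sum_nat_widen u m n : (forall i, 0 <= u i) -> (m <= n)%N ->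
  \sum_(0 <= i < m) u i <= \sum_(0 <= i < n) u i.
Proof.
move=> u0 mn; rewrite [leRHS](big_cat_nat (n := m)) //= lerDl.
by apply: sumr_ge0 => i _.
Qed.

Lemma bounded_sums_nneseries u : (forall i, 0 <= u i) ->
  (\sum_(0 <= n <oo) (u n)%:E < +oo)%E <-> bounded_sums u.
Proof.
move=> u0; have u0E n : (0 <= (u n)%:E)%E by rewrite lee_fin.
split=> [ufin|[B uB]].
- have sge0 : (0 <= \sum_(0 <= n <oo) (u n)%:E)%E by apply: nneseries_ge0.
  exists (fine (\sum_(0 <= n <oo) (u n)%:E)%E) => n.
  rewrite -lee_fin fineK ?ge0_fin_numE // -sumEFin.
  exact: nneseries_lim_ge.
- apply: (@le_lt_trans _ _ B%:E); last exact: ltry.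
  apply: lime_le; first exact: is_cvg_nneseries.
  by near=> n; rewrite sumEFin lee_fin.
Unshelve. all: by end_near. Qed.

(** The threshold 1 serves both later uses: an indicator below 1 is 0, and a [jump_prob] below 1
    excludes a [stake] equal to the square root of the variance. *)
Lemma bounded_sums_near_lt1 u : (forall i, 0 <= u i) -> bounded_sums u ->
  \forall n \near \oo, u n < 1.
Proof.
move=> u0 [B uB].
have : u n @[n --> \oo] --> (0 : R).
  apply: cvg_series_cvg_0; apply: nondecreasing_is_cvgn.
    by move=> m n mn; apply: ler_sum_nat_widen.
  by exists B => _ [n _ <-]; apply: uB.
by move/cvgrPdist_lt => /(_ 1 ltr01); apply: filterS => n;
  rewrite sub0r normrN; apply: le_lt_trans; apply: ler_norm.
Qed.

Lemma near_bounded_sums u B : (forall i, 0 <= u i) ->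
  (\forall n \near \oo, \sum_(0 <= i < n) u i <= B) -> bounded_sums u.
Proof.
move=> u0 [k _ kB]; exists B => n.
apply: (le_trans (ler_sum_nat_widen u n (maxn n k) u0 (leq_maxl _ _))).
by apply: kB => /=; apply: leq_maxr.
Qed.

Lemma eq_near_bounded_sums u w : (forall i, 0 <= w i) ->
  (\forall n \near \oo, u n = w n) -> bounded_sums w -> bounded_sums u.
Proof.
move=> w0 [k _ kuw] [B wB].
exists (\sum_(0 <= i < k) `|u i| + B) => n.
apply: (@le_trans _ _ (\sum_(0 <= i < n) ((i < k)%:R * `|u i| + w i))).
  apply: ler_sum => i _; case: ltnP => [ik|ki].
    by rewrite mul1r; apply: (le_trans (ler_norm _)); rewrite lerDl.
  by rewrite mul0r add0r kuw.
rewrite big_split /= lerD //.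
apply: (le_trans (ler_sum_nat_widen _ n (maxn n k) _ (leq_maxl _ _))).
  by move=> i; rewrite mulr_ge0.
rewrite [leLHS](big_cat_nat (n := k)) ?leq_maxr //= [X in _ + X]big_nat_cond.
rewrite [X in _ + X]big1 ?addr0; last first.
  by move=> i /andP[/andP[ki _] _]; rewrite ltnNge ki mul0r.
by apply: ler_sum_nat => i /andP[_ ik]; rewrite ik mul1r.
Qed.

End BoundedSums.

(** * Arithmetic means of a sequence *)

Section Averages.
Variable R : realType.
Implicit Type d : nat -> R.

Lemma near0_cvg_average d : (\forall n \near \oo, d n = 0) ->
  (n.+1%:R^-1 * \sum_(0 <= i < n.+1) d i) @[n --> \oo] --> (0 : R).
Proof.
move=> [k _ kd0].
apply: (@cvg_trans _ (n.+1%:R^-1 * \sum_(0 <= i < k) d i @[n --> \oo])).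
  apply: near_eq_cvg; apply: filterS (nbhs_infty_ge k) => n kn.
  rewrite [in RHS](big_cat_nat (n := k)) //= ?(leqW kn) //.
  rewrite [X in _ + X]big_nat_cond [X in _ + X]big1 ?addr0 //.
  by move=> i /andP[/andP[ki _] _]; apply: kd0.
have := cvgM (@cvg_harmonic R) (cvg_cst (\sum_(0 <= i < k) d i)).
by rewrite mul0r; apply.
Qed.

(** [d n] is the difference of two consecutive partial sums, each eventually smaller in absolute
    value than half its number of terms. *)
Lemma cvg_average_near_lt d :
  (n.+1%:R^-1 * \sum_(0 <= i < n.+1) d i) @[n --> \oo] --> (0 : R) ->
  \forall n \near \oo, `|d n| < n.+1%:R.
Proof.
move/cvgrPdist_lt => /(_ (2^-1)); rewrite invr_gt0 ltr0n => /(_ isT) [k _ kS].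
have S_lt n : (k <= n)%N -> `|\sum_(0 <= i < n.+1) d i| < n.+1%:R / 2.
  move=> /kS; rewrite /= sub0r normrN normrM ger0_norm ?invr_ge0 //.
  by rewrite -ltr_pdivlMl ?invr_gt0 // invrK.
exists k.+1 => //= -[//|n] kn.
have := S_lt n.+1 (ltnW kn); have := S_lt n kn.
rewrite [in X in _ -> X < _ -> _]big_nat_recr //= !ltr_norml.
rewrite -[n.+2%:R]natr1; have := ler0n R n.+1.
by move: (\sum_(_ <= _ < _) _) => s; lra.
Qed.

End Averages.

(** * The three-point choice and the one-step inequality for the potential *)

Section Reality.
Variable R : realType.
Implicit Types (p : play R) (n : nat).

(* The two bounds in the mean need not be attained at the same point; but if f is
   nowhere negative it vanishes wherever the weight is positive. *)
Lemma three_point_choice (q a c : R) (f g : R -> R) : 0 <= q <= 1 ->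
  (1 - q) * f 0 + q / 2 * (f a + f (- a)) <= 0 ->
  (1 - q) * g 0 + q / 2 * (g a + g (- a)) <= c ->
  exists2 d, d \in [:: 0; a; - a] & f d < 0 \/ f d <= 0 /\ g d <= c.
Proof.
move=> /andP[q0 q1] fle gle.
have [in0 ina inN] : [/\ 0 \in [:: 0; a; - a], a \in [:: 0; a; - a]
    & - a \in [:: 0; a; - a]] by rewrite !inE !eqxx !orbT.
have [f0|f0] := ltP (f 0) 0; first by exists 0 => //; left.
have [fa|fa] := ltP (f a) 0; first by exists a => //; left.
have [fN|fN] := ltP (f (- a)) 0; first by exists (- a) => //; left.
have [q_eq0|qn0] := eqVneq q 0.
  by exists 0 => //; right; move: fle gle; rewrite q_eq0; split; lra.
have q_gt0 : 0 < q by rewrite lt0r qn0.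
have fa0 : f a <= 0 /\ f (- a) <= 0.
  have h : 0 <= (1 - q) * f 0 by rewrite mulr_ge0 // subr_ge0.
  have : f a + f (- a) <= 0 by rewrite -(pmulr_rle0 _ q_gt0); lra.
  by split; lra.
have [ga|ga] := leP (g a) c; first by exists a => //; right; case: fa0.
have [gN|gN] := leP (g (- a)) c; first by exists (- a) => //; right; case: fa0.
(* Only the point 0 remains: as [g] exceeds [c] at both [a] and [- a], the mean of [g] forces
   [q < 1] and [g 0 <= c]. *)
have h : q * (2 * c) < q * (g a + g (- a)) by rewrite ltr_pM2l //; lra.
have q_lt1 : 0 < 1 - q.
  rewrite lt_neqAle subr_ge0 q1 andbT eq_sym subr_eq0.
  by apply/eqP => q_eq1; move: gle h; rewrite -q_eq1; lra.
exists 0 => //; right; split.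
  rewrite -(pmulr_rle0 _ q_lt1).
  have : 0 <= q * (f a + f (- a)) by rewrite mulr_ge0 ?addr_ge0.
  by lra.
by rewrite -(ler_pM2l q_lt1); lra.
Qed.

(* 2^x e^(-y) + 2^(-x) e^(y/2) *)
Definition potential (x y : R) : R :=
  expR (ln 2 * x - y) + expR (y / 2 - ln 2 * x).

Lemma potential_gt0 x y : 0 < potential x y.
Proof. by rewrite addr_gt0 ?expR_gt0. Qed.

(** In the mean, the two terms are multiplied by [(1 + q) e^(-q)] and [(1 - q/2) e^(q/2)], both at
    most 1 because [1 + z <= e^z]. *)
Lemma potential_step q x y : 0 <= q <= 1 ->
  (1 - q) * potential x (y + q) + q * potential (x + 1) (y + q)
    <= potential x y.
Proof.
move=> /andP[q0 q1]; rewrite /potential.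
have E2 : expR (ln 2) = 2 :> R by rewrite lnK // posrE.
have -> : ln 2 * (x + 1) - (y + q) = ln 2 + ((ln 2 * x - y) - q) by ring.
have -> : ln 2 * x - (y + q) = (ln 2 * x - y) - q by ring.
have -> : (y + q) / 2 - ln 2 * (x + 1) = - ln 2 + (y / 2 - ln 2 * x + q / 2).
  by field.
have -> : (y + q) / 2 - ln 2 * x = y / 2 - ln 2 * x + q / 2 by field.
rewrite !expRD !expRN E2.
set E := expR (ln 2 * x); set F := expR y.
set s := E / F; set t := expR (y / 2) / E.
have s0 : 0 <= s by rewrite divr_ge0 ?expR_ge0.
have t0 : 0 <= t by rewrite divr_ge0 ?expR_ge0.
have hs : (1 + q) * (expR q)^-1 <= 1.
  by rewrite ler_pdivrMr ?expR_gt0 // mul1r expR_ge1Dx.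
have ht : (1 - q / 2) * expR (q / 2) <= 1.
  rewrite -ler_pdivlMr ?expR_gt0 // mul1r -expRN.
  by have := expR_ge1Dx (- (q / 2) : R).
have := ler_wpM2l s0 hs; have := ler_wpM2l t0 ht.
by lra.
Qed.

Lemma potential_ge x y :
  (ln 2 * x - y <= potential x y) /\ (y / 2 - ln 2 * x <= potential x y).
Proof.
rewrite /potential; split; [set z := ln 2 * x - y|set z := y / 2 - _];
  have := expR_ge1Dx z.
- by have := expR_ge0 (y / 2 - ln 2 * x); lra.
- by have := expR_ge0 (ln 2 * x - y); lra.
Qed.

(** * Jumps along a play and the requirement on a single round *)

Definition deviation p n : R := outcome (p n) - fmean (forecast (p n)).
Definition variance p n : R := (fvar (forecast (p n)))%:num.
Definition stake p n : R := Num.max n.+1%:R (Num.sqrt (variance p n)).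
Definition jump_prob p n : R := variance p n / stake p n ^+ 2.
Definition jump p n : R := (deviation p n != 0)%:R.

Definition play_potential p n : R :=
  potential (\sum_(0 <= i < n) jump p i) (\sum_(0 <= i < n) jump_prob p i).

(** The third clause says that [(1 - K) / L] does not decrease, cleared of denominators so that it
    makes sense for every capital. It says nothing about the potential when [capital p n = 1]; the
    last clause covers a capital that stays at 1. *)
Definition good_round p n : Prop :=
  [/\ deviation p n \in [:: 0; stake p n; - stake p n],
      capital p n.+1 <= 1,
      (1 - capital p n) * play_potential p n.+1 <=
        (1 - capital p n.+1) * play_potential p n
    & capital p n.+1 = 1 -> play_potential p n.+1 <= play_potential p n].

Lemma variance_ge0 p n : 0 <= variance p n.
Proof. by rewrite /variance. Qed.

Lemma stake_ge p n : n.+1%:R <= stake p n.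
Proof. by rewrite le_max lexx. Qed.

Lemma stake_gt0 p n : 0 < stake p n.
Proof. by apply: lt_le_trans (stake_ge p n); rewrite ltr0n. Qed.

Lemma jump_prob_ge0 p n : 0 <= jump_prob p n.
Proof. by rewrite divr_ge0 ?variance_ge0 ?sqr_ge0. Qed.

Lemma jump_prob_le1 p n : jump_prob p n <= 1.
Proof.
rewrite ler_pdivrMr ?exprn_gt0 ?stake_gt0 // mul1r.
rewrite -[leLHS]sqr_sqrtr ?variance_ge0 // ler_sqr ?nnegrE ?sqrtr_ge0 //.
  by rewrite le_max lexx orbT.
exact: ltW (stake_gt0 p n).
Qed.

(** Reality sees a finite history only, so a candidate outcome is judged on an arbitrary
    continuation of it. *)
Lemma good_round_eq p p' n : (forall i, (i <= n)%N -> p i = p' i) ->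
  good_round p n <-> good_round p' n.
Proof.
move=> pp'.
have cap m : (m <= n.+1)%N -> capital p m = capital p' m.
  by elim: m => //= m IH mn; rewrite IH ?(ltnW mn) // pp'.
have pot m : (m <= n.+1)%N -> play_potential p m = play_potential p' m.
  move=> mn; rewrite /play_potential; congr potential;
    apply: eq_big_nat => i /andP[_ im];
    by rewrite /jump /jump_prob /stake /variance /deviation pp' //
               -ltnS (leq_trans im).
rewrite /good_round !cap ?pot //.
by rewrite /deviation /stake /variance pp'.
Qed.

(** * The strategy of Reality *)

Definition set_outcome p n y : play R :=
  fun i => if i == n then Round (forecast (p n)) (bet (p n)) y else p i.

(** With weights [1 - q], [q / 2], [q / 2] on the deviations 0, [a], [- a], the gain has mean 0 and
    the next potential has mean at most the current one. [three_point_choice] then selects a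
    deviation. *)
Lemma exists_good_outcome p n : capital p n <= 1 ->
  exists y, good_round (set_outcome p n y) n.
Proof.
move=> K1.
set K := capital p n; set q := jump_prob p n; set a := stake p n.
pose x := \sum_(0 <= i < n) jump p i.
pose w := \sum_(0 <= i < n) jump_prob p i.
pose L := potential x w.
pose g (d : R) := slin (bet (p n)) * d
  + (squad (bet (p n)))%:num * (d ^+ 2 - variance p n).
pose L' (d : R) := potential (x + (d != 0)%:R) (w + q).
have L0 : 0 < L by exact: potential_gt0.
have L'0 d : 0 < L' d by exact: potential_gt0.
suff [d din [gd1 gdL gdE]] : exists2 d, d \in [:: 0; a; - a] &
    [/\ K + g d <= 1, (1 - K) * L' d <= (1 - (K + g d)) * L
      & K + g d = 1 -> L' d <= L].
  exists (fmean (forecast (p n)) + d); set p' := set_outcome _ _ _.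
  have p'lt i : (i < n)%N -> p' i = p i.
    by rewrite /p' /set_outcome; case: eqP => // ->; rewrite ltnn.
  have p'n : p' n = Round (forecast (p n)) (bet (p n)) (fmean (forecast (p n)) + d).
    by rewrite /p' /set_outcome eqxx.
  have devn : deviation p' n = d by rewrite /deviation p'n /= addrAC subrr add0r.
  have cap m : (m <= n)%N -> capital p' m = capital p m.
    by elim: m => //= m IH mn; rewrite IH ?(ltnW mn) // p'lt.
  have capS : capital p' n.+1 = K + g d.
    rewrite /= cap //; congr (_ + _).
    by rewrite /gain -/(deviation p' n) devn p'n.
  have stk : stake p' n = a by rewrite /stake /variance p'n.
  have jp : jump_prob p' n = q by rewrite /jump_prob stk /variance p'n.
  have xE : \sum_(0 <= i < n) jump p' i = x.
    by apply: eq_big_nat => i /andP[_ im]; rewrite /jump /deviation p'lt.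
  have wE : \sum_(0 <= i < n) jump_prob p' i = w.
    apply: eq_big_nat => i /andP[_ im].
    by rewrite /jump_prob /stake /variance p'lt.
  have pot : play_potential p' n = L by rewrite /play_potential xE wE.
  have potS : play_potential p' n.+1 = L' d.
    by rewrite /play_potential !big_nat_recr //= xE wE jp /jump devn.
  by split; rewrite ?capS ?pot ?potS ?stk ?devn ?(cap n).
have q01 : 0 <= q <= 1 by rewrite jump_prob_ge0 jump_prob_le1.
have a0 : 0 < a by exact: stake_gt0.
have an0 : a != 0 by rewrite gt_eqF.
have qa : q * a ^+ 2 = variance p n.
  by rewrite /q /jump_prob -/a divfK // expf_neq0.
have gmean : (1 - q) * g 0 + q / 2 * (g a + g (- a)) = 0.
  by rewrite /g -qa; field.
have L'mean : (1 - q) * L' 0 + q / 2 * (L' a + L' (- a)) <= L.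
  rewrite /L' eqxx oppr_eq0 an0 /= addr0.
  by have := potential_step q x w q01; rewrite -/L; lra.
case: (ltrgtP K 1) (K1) => // [K_lt1|K_eq1] _.
  (* [h d <= (1 - K) * L] is the third clause rearranged. This single inequality suffices, hence the
     zero function as [f] below. *)
  pose h (d : R) := g d * L + (1 - K) * L' d.
  have hmean : (1 - q) * h 0 + q / 2 * (h a + h (- a)) <= (1 - K) * L.
    rewrite (_ : _ + _ = ((1 - q) * g 0 + q / 2 * (g a + g (- a))) * L
      + (1 - K) * ((1 - q) * L' 0 + q / 2 * (L' a + L' (- a)))); last first.
      by rewrite /h; ring.
    by rewrite gmean mul0r add0r ler_pM2l // subr_gt0.
  have zmean : (1 - q) * 0 + q / 2 * (0 + 0) <= 0 :> R.
    by rewrite addr0 !mulr0 addr0.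
  have [d din [|[_ hd]]] := three_point_choice q a _ (fun=> 0) h q01 zmean hmean.
    by rewrite ltxx.
  have step : (1 - K) * L' d <= (1 - (K + g d)) * L.
    by move: hd; rewrite /h; lra.
  (* The left side of [step] is positive, so the capital stays strictly below 1 and the last clause
     holds vacuously. *)
  have pos : 0 < 1 - (K + g d).
    rewrite -(pmulr_lgt0 _ L0); apply: lt_le_trans step.
    by rewrite mulr_gt0 // subr_gt0.
  by exists d => //; split=> //; lra.
have gmean_le0 : (1 - q) * g 0 + q / 2 * (g a + g (- a)) <= 0 by rewrite gmean.
(* At capital 1, either the gain is negative and the capital drops below 1, or it is at most 0 and
   the potential does not rise. *)
have [d din gd] := three_point_choice q a _ g L' q01 gmean_le0 L'mean.
exists d => //; rewrite K_eq1 subrr mul0r; case: gd => [gd|[gd L'd]]; split.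
- by lra.
- by rewrite mulr_ge0 ?(ltW L0) //; lra.
- by lra.
- by lra.
- by rewrite mulr_ge0 ?(ltW L0) //; lra.
- by [].
Qed.

(** The default of [nth] extends the history to an infinite play by repeating the current round. The
    value 0 is returned only if no outcome is good, which [exists_good_outcome] excludes while the
    capital is at most 1. *)
Definition reality : reality_strategy R := fun s f b =>
  xget 0 [set y | good_round (nth (Round f b y) (rcons s (Round f b y))) (size s)].

Lemma reality_good_round p n : follows reality p -> good_round p n.
Proof.
move=> followsp.
(* A good round keeps the capital at most 1, which is what the existence of the next good outcome
   requires. *)
suff step m : capital p m <= 1 -> good_round p m.
  apply: (step); elim: n => [|n IH]; first by rewrite /= lexx.
  by have [] := step n IH.
move=> cap1.
pose P y := good_round (nth (Round (forecast (p m)) (bet (p m)) y)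
  (rcons (mkseq p m) (Round (forecast (p m)) (bet (p m)) y))) m.
have PE y : P y <-> good_round (set_outcome p m y) m.
  apply: good_round_eq => i im; rewrite nth_rcons size_mkseq /set_outcome.
  case: ltngtP im => // im _; first by rewrite nth_mkseq.
have [y /PE Py] := exists_good_outcome p m cap1.
have : P (outcome (p m)).
  rewrite followsp /reality size_mkseq.
  by apply: (@xgetPex _ 0 P); exists y.
move/PE; apply: (iffLR (good_round_eq _ _ _ _)) => i im.
by rewrite /set_outcome; case: eqP => // ->; case: (p m).
Qed.

(** * Bounding the potential and deducing the event *)

Lemma capital_le1 p n : follows reality p -> capital p n <= 1.
Proof.
case: n => [|n] fp; first by rewrite /= lexx.
by have [] := reality_good_round p n fp.
Qed.

(** If the capital differs from 1 at some round [k], monotonicity of the ratio gives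
    [L_m <= L_k (1 - K_m) / (1 - K_k)] for [m >= k], and the duty gives [1 - K_m <= 1]. *)
Lemma play_potential_bounded p : follows reality p -> collateral_duty p ->
  exists C, \forall n \near \oo, play_potential p n <= C.
Proof.
move=> fp duty; have L0 n : 0 < play_potential p n by exact: potential_gt0.
have [K1|] := pselect (forall n, capital p n = 1).
  exists (play_potential p 0); apply: nearW; elim=> // n; apply: le_trans.
  by have [_ _ _ ->] := reality_good_round p n fp.
move=> /existsNP[k Kk].
have K_lt1 : 0 < 1 - capital p k.
  by rewrite subr_gt0 lt_neqAle capital_le1 // andbT; apply/eqP.
exists (play_potential p k / (1 - capital p k)).
apply: filterS (nbhs_infty_ge k) => m km.
suff : (1 - capital p k) * play_potential p m
       <= (1 - capital p m) * play_potential p k.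
  move=> le_m; rewrite ler_pdivlMr // mulrC; apply: le_trans le_m _.
  by rewrite ler_piMl ?(ltW (L0 k)) // gerBl duty.
elim: m km => [|m IH]; first by rewrite leqn0 => /eqP ->.
rewrite leq_eqVlt => /predU1P[<- //|/IH{}IH].
have [_ _ step _] := reality_good_round p m fp.
(* The two ratio inequalities are chained after multiplying by the positive potential at [m]. *)
rewrite -(ler_pM2r (L0 m)) mulrAC.
apply: (le_trans (ler_wpM2r (ltW (L0 m.+1)) IH)).
rewrite mulrAC [leRHS]mulrAC.
by rewrite ler_pM2r.
Qed.

(** Once the potential is at most [C], its two terms give [P <= 2 (C + N ln 2)] and
    [N ln 2 <= C + P], with [N] and [P] the partial sums of [jump] and [jump_prob]. *)
Lemma bounded_jumps p : follows reality p -> collateral_duty p ->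
  bounded_sums R (jump p) <-> bounded_sums R (jump_prob p).
Proof.
move=> fp duty; have [C LC] := play_potential_bounded p fp duty.
have ln2 : 0 < ln 2 :> R by rewrite ln_gt0 // ltr1n.
split=> -[B SB].
- apply: (near_bounded_sums _ _ (2 * (C + ln 2 * B))); first exact: jump_prob_ge0.
  apply: filterS LC => n LC.
  have [_ ] := potential_ge (\sum_(0 <= i < n) jump p i)
    (\sum_(0 <= i < n) jump_prob p i).
  have := ler_wpM2l (ltW ln2) (SB n); move: LC; rewrite /play_potential; lra.
- apply: (near_bounded_sums _ _ ((C + B) / ln 2)); first by move=> i; exact: ler0n.
  apply: filterS LC => n LC; rewrite ler_pdivlMr // mulrC.
  have [+ _] := potential_ge (\sum_(0 <= i < n) jump p i)
    (\sum_(0 <= i < n) jump_prob p i).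
  by have := SB n; move: LC; rewrite /play_potential; lra.
Qed.

(** If the probabilities have bounded sums, they are eventually below 1. A stake equal to the square
    root of the variance would make them 1, so eventually the stake is [n.+1] and the terms
    coincide. The converse is termwise comparison. *)
Lemma bounded_jump_prob p :
  bounded_sums R (jump_prob p) <->
  bounded_sums R (fun n => variance p n / n.+1%:R ^+ 2).
Proof.
split; last first.
  move=> [B SB]; exists B => n; apply: le_trans (SB n).
  apply: ler_sum => i _; rewrite ler_wpM2l ?variance_ge0 //.
  rewrite lef_pV2 ?posrE ?exprn_gt0 ?stake_gt0 ?ltr0n //.
  by rewrite ler_sqr ?nnegrE ?ler0n ?(ltW (stake_gt0 p i)) ?stake_ge.
move=> bP; apply: eq_near_bounded_sums (bP); first exact: jump_prob_ge0.
apply: filterS (bounded_sums_near_lt1 _ _ (jump_prob_ge0 p) bP) => n.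
rewrite ltr_pdivrMr ?exprn_gt0 ?stake_gt0 // mul1r => lt_var.
rewrite /jump_prob; congr (_ / _ ^+ 2).
rewrite /stake; case: (leP n.+1%:R) => // le_sqrt.
move: lt_var; rewrite /stake max_r // sqr_sqrtr ?variance_ge0 //.
by rewrite ltxx.
Qed.

(** Boundedly many jumps leave deviations that are eventually 0. Conversely, vanishing averages make
    the deviation at [n] eventually smaller than [n.+1], the least size of a jump. *)
Lemma bounded_jumps_cvg p : follows reality p ->
  bounded_sums R (jump p) <->
  ((n.+1%:R^-1 * \sum_(0 <= i < n.+1) deviation p i) @[n --> \oo] --> (0 : R)).
Proof.
move=> fp; have jump0 n : 0 <= jump p n by exact: ler0n.
split=> [bN|/cvg_average_near_lt near_lt].
  apply: near0_cvg_average.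
  apply: filterS (bounded_sums_near_lt1 _ _ jump0 bN) => n.
  by rewrite /jump; case: eqP => //; rewrite ltxx.
apply: (eq_near_bounded_sums _ _ (fun=> 0)) => //; last first.
  by exists 0 => n; rewrite big1.
apply: filterS near_lt => n; have [] := reality_good_round p n fp.
rewrite /jump !inE => /or3P[] /eqP -> _ _ _; first by rewrite eqxx.
- by rewrite gtr0_norm ?stake_gt0 // ltNge stake_ge.
- by rewrite normrN gtr0_norm ?stake_gt0 // ltNge stake_ge.
Qed.

End Reality.

Theorem theorem4p1 (R : realType) :
  @can_strongly_comply R
    [set xi : game_path R |
      (\sum_(0 <= n <oo) ((fvar (xi n).1)%:num / n.+1%:R ^+ 2)%:E < +oo)%E
      <->
      (n.+1%:R^-1 * \sum_(0 <= i < n.+1) ((xi i).2 - fmean (xi i).1) : R)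
        @[n --> \oo] --> (0 : R)].
Proof.
exists (reality R) => p fp duty; split; last by move=> n; exact: capital_le1.
rewrite /=; apply: (iff_trans (bounded_sums_nneseries R _ _)).
  by move=> n; rewrite divr_ge0 ?sqr_ge0.
apply: iff_trans (iff_sym (bounded_jump_prob R p)) _.
apply: iff_trans (iff_sym (bounded_jumps R p fp duty)) _.
exact: bounded_jumps_cvg.
Qed.
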